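(* Fix $\Delta x,\Delta y>0$. For each $K$ let $\mathcal E=\mathcal E(\mathbf k)\in\mathbb C^{3(K+1)^2\times 3(K+1)^2}$ be the evolution matrix of the Discontinuous Galerkin method of degree $K$ for two-dimensional linear acoustics with the Rusanov flux, i.e. with $D_x=D_y$ equal to the $3\times3$ identity matrix. Then $$\min_{\mathbf k\in\mathbb R^2}\dim\ker\mathcal E(\mathbf k)=\begin{cases}0&\text{if }K\in\{0,1\},\\1&\text{if }K=2.\end{cases}$$ In particular the method is not stationarity preserving for $K=0$ and $K=1$, and it is stationarity preserving for $K=2$.
   Context: Linear acoustics in 2D with variables $q=(u,v,p)$: $\partial_t q+J_x\partial_x q+J_y\partial_y q=0$ with $$J_x=\begin{pmatrix}0&0&1\\0&0&0\\1&0&0\end{pmatrix},\qquad J_y=\begin{pmatrix}0&0&0\\0&0&1\\0&1&0\end{pmatrix}.$$ For this system $\min_{\mathbf k}\dim\ker(J_xk_x+J_yk_y)=1$. Basis: $b_0,\dots,b_K$ is the $L^2(-\frac12,\frac12)$-orthonormal polynomial basis with $\deg b_k=k$ ($b_0=1$, $b_1=2\sqrt3x$, $b_2=\frac{\sqrt5}{2}(12x^2-1)$), so the mass matrix is $M^k_\alpha=\delta_{k\alpha}$. Put $G^k_\alpha=\int_{-1/2}^{1/2}b_k'(\xi)b_\alpha(\xi)\,d\xi$. Numerical fluxes: $\hat f^x(q_L,q_R)=J_x\frac{q_L+q_R}{2}-D_x\frac{q_R-q_L}{2}$, and analogously $\hat f^y$ with $J_y,D_y$; $D_x,D_y$ are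 $3\times3$ matrices. Evolution matrix: for $\mathbf k=(k_x,k_y)$ let $t_x=e^{\mathrm ik_x\Delta x}$, $t_y=e^{\mathrm ik_y\Delta y}$. Inserting $q_{ij}^{(\alpha\beta)}(t)=\hat q^{(\alpha\beta)}(t)t_x^it_y^j$ (with $\hat q^{(\alpha\beta)}\in\mathbb C^3$) in the semi-discrete DG method of tensor-product degree $K$ on the Cartesian grid with spacings $\Delta x,\Delta y$ yields $\frac{d}{dt}\hat q^{(k\ell)}+\sum_{\alpha,\beta=0}^K\mathcal E^{k\ell}_{\alpha\beta}\hat q^{(\alpha\beta)}=0$, where the $3\times3$ blocks of $\mathcal E$ are $$\begin{aligned}\mathcal E^{k\ell}_{\alpha\beta}=&-\tfrac1{\Delta x}J_xM^\ell_\beta G^k_\alpha-\tfrac1{\Delta y}J_yM^k_\alpha G^\ell_\beta\\&+\frac{b_k(\frac12)t_x-b_k(-\frac12)}{t_x\Delta x}\left(J_x\frac{b_\alpha(\frac12)+t_xb_\alpha(-\frac12)}2-D_x\frac{t_xb_\alpha(-\frac12)-b_\alpha(\frac12)}2\right)M^\ell_\beta\\&+\frac{b_\ell(\frac12)t_y-b_\ell(-\frac12)}{t_y\Delta y}\left(J_y\frac{b_\beta(\frac12)+t_yb_\beta(-\frac12)}2-D_y\frac{t_yb_\beta(-\frac12)-b_\beta(\frac12)}2\right)M^k_\alpha .\end{aligned}$$ Stationarity preserving: a linear method with $N_{\mathrm{dof}}$ degrees of freedom per cell per variable (here $N_{\mathrm{dof}}=(K+1)^2$), for a system with $\min_{\mathbf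 k}\dim\ker(\mathbf J\cdot\mathbf k)=1$, is called stationarity preserving if $1\le\min_{\mathbf k}\dim\ker\mathcal E\le N_{\mathrm{dof}}$. *)

(* Defs.v *)
From HB Require Import structures.
From mathcomp Require Import all_boot all_order all_algebra.
From mathcomp Require Import complex ring lra.
From mathcomp Require Import all_classical all_reals all_analysis.

Set Implicit Arguments.
Unset Strict Implicit.
Unset Printing Implicit Defensive.

Import Order.TTheory GRing.Theory Num.Theory.
Import numFieldNormedType.Exports.

Local Open Scope ring_scope.
Local Open Scope complex_scope.

(* [cokermx A] is the library's kernel for the action on column vectors: its
   columns span [{v | A *m v = 0}]. *)
Definition dim_ker (F : fieldType) (n : nat) (A : 'M[F]_n) : nat :=
  \rank (cokermx A).

(* [m = min_{k in R^2} dim ker A(k)]; the minimum is required to be attained. *)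
Definition is_min_dim_ker (R : realType) (n : nat) (A : R -> R -> 'M[R[i]]_n)
    (m : nat) : Prop :=
  (exists kx ky, dim_ker (A kx ky) = m) /\
  (forall kx ky, (m <= dim_ker (A kx ky))%N).

(* For a method with [Ndof] degrees of freedom per cell and variable, applied
   to a system with [min_k dim ker (J . k) = 1]. *)
Definition stationarity_preserving (R : realType) (n : nat)
    (E : R -> R -> 'M[R[i]]_n) (Ndof : nat) : Prop :=
  exists2 m, is_min_dim_ker E m & (1 <= m <= Ndof)%N.

Section Acoustics.
Variable R : realType.
Notation C := R[i].

Definition Jx : 'M[C]_3 := \matrix_(i, j) nth 0 (nth [::]
  [:: [:: 0; 0; 1];
      [:: 0; 0; 0];
      [:: 1; 0; 0]] i) j.

Definition Jy : 'M[C]_3 := \matrix_(i, j) nth 0 (nth [::]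
  [:: [:: 0; 0; 0];
      [:: 0; 0; 1];
      [:: 0; 1; 0]] i) j.

Definition acoustics_symbol (kx ky : R) : 'M[C]_3 := kx%:C *: Jx + ky%:C *: Jy.

Lemma acoustics_min_dim_ker : is_min_dim_ker acoustics_symbol 1.
Proof.
have A_le (kx ky : R) : (\rank (acoustics_symbol kx ky) < 3)%N.
  set A := acoustics_symbol kx ky.
  rewrite ltn_neqAle rank_leq_row andbT; apply/negP => fr.
  have Au : A \in unitmx by rewrite -row_free_unit.
  pose v : 'cV[R[i]]_3 := \matrix_(i, j) nth (0 : R[i]) [:: (ky%:C : R[i]); - (kx%:C : R[i]); 0] i.
  have Av : A *m v = 0.
    apply/matrixP => i j; rewrite !mxE !big_ord_recl big_ord0 !mxE.
    case: i => [[|[|[|//]]] ?] /=;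
    rewrite ?(mulr0, mul0r, addr0, add0r, mulr1, mul1r) //.
    by rewrite mulrN mulrC subrr.
  have v0 : v = 0 by rewrite -(mulKmx Au v) Av mulmx0.
  have ky0 : ky%:C = 0 by move/matrixP/(_ 0 0): v0; rewrite !mxE.
  have kx0 : kx%:C = 0 by move/matrixP/(_ 1 0): v0; rewrite !mxE => /eqP; rewrite oppr_eq0 => /eqP.
  by move: fr; rewrite /A /acoustics_symbol kx0 ky0 !scale0r addr0 mxrank0.
split; last first.
  by move=> kx ky; rewrite /dim_ker mxrank_coker subn_gt0.
exists 1, 0; rewrite /dim_ker mxrank_coker.
have := A_le 1 0.
set A := acoustics_symbol 1 0.
suff : (2 <= \rank A)%N by case: (\rank A) => [|[|[|]]].
pose P : 'M[R[i]]_(2, 3) := \matrix_(i, j) ((j : nat) == 2 * i)%N%:R.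
pose Q : 'M[R[i]]_(3, 2) := \matrix_(i, j) ((i + 2 * j)%N == 2%N)%:R.
have e : P *m A *m Q = 1%:M.
  have -> : A = Jx by rewrite /A /acoustics_symbol scale1r scale0r addr0.
  apply/matrixP => i j; rewrite mxE !big_ord_recl big_ord0 !mxE.
  rewrite !big_ord_recl !big_ord0 !mxE.
  case: i => [[|[|//]] ?]; case: j => [[|[|//]] ?]; rewrite /= ?(mulr0, mul0r, addr0, add0r, mulr1, mul1r) //.
apply: (@leq_trans (\rank (P *m A *m Q))); first by rewrite e mxrank1.
exact: leq_trans (mxrankM_maxl _ _) (mxrankM_maxr _ _).
Qed.

Definition inner (p q : {poly R}) : R :=
  \int[lebesgue_measure]_(x in `[- 2^-1, 2^-1]%classic) (p.[x] * q.[x]).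

(* Degree and orthonormality determine [b k] up to sign; the sign is fixed by
   the positivity of the leading coefficient. *)
Definition orthonormal_basis (K : nat) (b : nat -> {poly R}) : Prop :=
  (forall k, (k <= K)%N -> size (b k) = k.+1 /\ 0 < lead_coef (b k)) /\
  (forall k l, (k <= K)%N -> (l <= K)%N -> inner (b k) (b l) = (k == l)%:R).

Lemma integral_poly (P : {poly R}) :
  \int[lebesgue_measure]_(x in `[- 2^-1, 2^-1]%classic) (P^`()).[x]
  = P.[2^-1] - P.[- 2^-1] :> R.
Proof.
have hc (Q : {poly R}) : continuous (horner Q) by exact: continuous_horner.
rewrite /Rintegral (@continuous_FTC2 _ _ (horner P)) //.
- by rewrite -subr_gt0 opprK; nra.
- exact: continuous_subspaceT.
- split.
  + by move=> x _; exact: derivable_horner.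
  + exact/cvg_at_right_filter/hc.
  + exact/cvg_at_left_filter/hc.
- by move=> x _; rewrite -derivE.
Qed.

Definition legendre012 (k : nat) : {poly R} := nth 0
  [:: 1; (2 * Num.sqrt 3) *: 'X; (Num.sqrt 5 / 2) *: (12 *: 'X^2 - 1)] k.

Lemma orthonormal_basis_legendre012 : orthonormal_basis 2 legendre012.
Proof.
have s3 : 0 < Num.sqrt (3 : R) by rewrite sqrtr_gt0.
have s5 : 0 < Num.sqrt (5 : R) by rewrite sqrtr_gt0.
have q3 : Num.sqrt (3 : R) ^+ 2 = 3 by rewrite sqr_sqrtr.
have q5 : Num.sqrt (5 : R) ^+ 2 = 5 by rewrite sqr_sqrtr.
have sz : size (12 *: 'X^2 - 1 : {poly R}) = 3.
  rewrite size_polyDl size_scale ?pnatr_eq0 // size_polyXn //.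
  by rewrite size_polyN size_poly1.
split.
  case=> [|[|[|//]]] _; rewrite /legendre012 /=.
  - by rewrite size_poly1 lead_coef1 ltr01.
  - have c0 : 0 < 2 * Num.sqrt (3 : R) by rewrite mulr_gt0.
    by rewrite lead_coefZ lead_coefX size_scale ?gt_eqF // size_polyX mulr1.
  - have c0 : 0 < Num.sqrt (5 : R) / 2 by rewrite divr_gt0.
    rewrite lead_coefZ size_scale ?gt_eqF // sz; split=> //.
    by rewrite mulr_gt0 // lead_coefE sz !coefE /= mulr1 subr0.
have fin c d m (p q P : {poly R}) : P^`() = (p * q) *+ m.+1 ->
    inner (c *: p) (d *: q) = c * d / m.+1%:R * (P.[2^-1] - P.[- 2^-1]).
  move=> e; transitivity (\int[lebesgue_measure]_(x in `[- 2^-1, 2^-1]%classic)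
    (((c * d / m.+1%:R) *: P)^`()).[x]); last first.
    by rewrite integral_poly !hornerZ -mulrBr.
  apply: eq_Rintegral => x _; rewrite derivZ e -[(p * q) *+ _]scaler_nat scalerA.
  by rewrite divfK ?pnatr_eq0 // !hornerZ hornerM mulrACA.
have sym (p q : {poly R}) : inner p q = inner q p.
  by apply: eq_Rintegral => x _; rewrite mulrC.
have e00 : inner 1 1 = 1 :> R.
  have := fin 1 1 0 1 1 'X; rewrite !scale1r derivX mulr1 => -> //.
  by rewrite !hornerE; field.
have e01 c : inner 1 (c *: 'X) = 0 :> R.
  have := fin 1 c 1 1 'X 'X^2; rewrite !scale1r derivXn mul1r => -> //.
  by rewrite !hornerE; field.
have e11 : inner ((2 * Num.sqrt 3) *: 'X) ((2 * Num.sqrt 3) *: 'X) = 1 :> R.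
  rewrite (@fin _ _ 2 _ _ 'X^3); last by rewrite derivXn.
  by rewrite mulrACA -(expr2 (Num.sqrt 3)) q3 !hornerE; field.
rewrite scaler_nat in sz.
have e02 c : inner 1 (c *: ('X^2 *+ 12 - 1)) = 0 :> R.
  have h x : ('X^3 *+ 4 - 'X).[x] = x ^+ 3 *+ 4 - x :> R.
    by rewrite hornerD hornerN hornerMn hornerXn hornerX.
  have := fin 1 c 0 1 ('X^2 *+ 12 - 1) ('X^3 *+ 4 - 'X).
  rewrite !scale1r !poly.derivE mul1r => ->; last by rewrite /=; ring.
  by rewrite !h; field.
have e12 c d : inner (c *: 'X) (d *: ('X^2 *+ 12 - 1)) = 0 :> R.
  have h x : ('X^4 *+ 6 - 'X^2).[x] = x ^+ 4 *+ 6 - x ^+ 2 :> R.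
    by rewrite hornerD hornerN hornerMn !hornerXn.
  rewrite (@fin _ _ 1 _ _ ('X^4 *+ 6 - 'X^2)); last by rewrite !poly.derivE /=; ring.
  by rewrite !h; field.
have e22 : inner ((Num.sqrt 5 / 2) *: ('X^2 *+ 12 - 1))
    ((Num.sqrt 5 / 2) *: ('X^2 *+ 12 - 1)) = 1 :> R.
  have h x : ('X^5 *+ 144 - 'X^3 *+ 40 + 'X *+ 5).[x]
      = x ^+ 5 *+ 144 - x ^+ 3 *+ 40 + x *+ 5 :> R.
    by rewrite hornerD hornerD hornerN hornerMn hornerMn hornerMn !hornerXn hornerX.
  rewrite (@fin _ _ 4 _ _ ('X^5 *+ 144 - 'X^3 *+ 40 + 'X *+ 5)); last first.
    by rewrite !poly.derivE /=; ring.
  by rewrite mulrACA -(expr2 (Num.sqrt 5)) q5 !h; field.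
rewrite -scaler_nat in sz e02 e12 e22.
case=> [|[|[|//]]] [|[|[|//]]] _ _; rewrite /legendre012 /= //; by rewrite // sym.
Qed.

Definition phase (theta : R) : C := cos theta +i* sin theta.

Section EvolutionMatrix.
Variables (b : nat -> {poly R}) (dx dy : R) (Dx Dy : 'M[C]_3).

Definition massC (k a : nat) : C := (inner (b k) (b a))%:C.
Definition stiffC (k a : nat) : C := (inner (b k)^`() (b a))%:C.
Definition bR (k : nat) : C := ((b k).[2^-1])%:C.
Definition bL (k : nat) : C := ((b k).[- 2^-1])%:C.

(* Flux [J (qL + qR) / 2 - D (qR - qL) / 2] between a cell and its successor,
   for the [a]-th mode with phase shift [t] from one cell to the next. *)
Definition flux_mode (J D : 'M[C]_3) (t : C) (a : nat) : 'M[C]_3 :=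
  ((bR a + t * bL a) / 2) *: J - ((t * bL a - bR a) / 2) *: D.

(* Row mode [(k, l)] is the test function, column mode [(a, c)] the unknown. *)
Definition evolution_block (kx ky : R) (k l a c : nat) : 'M[C]_3 :=
  let tx := phase (kx * dx) in
  let ty := phase (ky * dy) in
  - ((dx%:C)^-1 * massC l c * stiffC k a) *: Jx
  - ((dy%:C)^-1 * massC k a * stiffC l c) *: Jy
  + ((bR k * tx - bL k) / (tx * dx%:C) * massC l c) *: flux_mode Jx Dx tx a
  + ((bR l * ty - bL l) / (ty * dy%:C) * massC k a) *: flux_mode Jy Dy ty c.

Lemma evolution_matrix_size (K : nat) :
  (\sum_(k < K.+1) \sum_(l < K.+1) 3 = 3 * K.+1 ^ 2)%N.
Proof. by rewrite !sum_nat_const !card_ord mulnA mulnC. Qed.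

(* Modes [(k, l)] in lexicographic order, three variables per mode; the size
   is [3 (K + 1) ^ 2], written as the iterated sum that [\mxblock] produces. *)
Definition evolution_matrix (K : nat) (kx ky : R) :
    'M[C]_(\sum_(k < K.+1) \sum_(l < K.+1) 3) :=
  \mxblock_(k < K.+1, a < K.+1) \mxblock_(l < K.+1, c < K.+1)
    evolution_block kx ky k l a c.

End EvolutionMatrix.

Definition rusanov_evolution_matrix (b : nat -> {poly R}) (dx dy : R) (K : nat) :=
  evolution_matrix b dx dy 1%:M 1%:M K.

End Acoustics.

(* Main.v *)
(** Writing D for the derivative in an orthonormal basis, integration by parts
    turns the central part of each one-dimensional operator into a
    skew-Hermitian matrix, while the Rusanov diffusion is [j^* j / 2] with [j]
    the jump functional across the (Bloch-shifted) interface.  Hence the real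
    part of the energy identity forces all jumps of a kernel vector to vanish,
    and on jump-free fields the central operator is D itself: ker E is the space
    of continuous Bloch-periodic polynomial fields with zero pressure gradient
    and zero divergence.

    With both phases equal to -1 these conditions leave nothing for K = 0, 1 and
    one dimension for K = 2.  For K = 2 and arbitrary phases, a continuous linear
    function and its continuous quadratic primitive in each direction yield a
    divergence-free velocity field, so the kernel is never trivial. *)

Require Import Defs.
From mathcomp Require Import all_boot all_order all_algebra.
From mathcomp Require Import complex ring lra.
From mathcomp Require Import all_classical all_reals all_analysis.

Set Implicit Arguments.
Unset Strict Implicit.
Unset Printing Implicit Defensive.

Import Order.TTheory GRing.Theory Num.Theory.
Import numFieldNormedType.Exports.

Local Open Scope ring_scope.

(** * The inner product on the reference cell and orthonormal polynomial bases *)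

Section InnerProduct.
Variable R : realType.
Implicit Types p q r : {poly R}.

Lemma integrable_horner p : (@lebesgue_measure R).-integrable
  `[- 2^-1, 2^-1]%classic (EFin \o horner p).
Proof.
apply: continuous_compact_integrable; first exact: segment_compact.
by apply: continuous_subspaceT; exact: continuous_horner.
Qed.

Lemma innerE p q : inner p q =
  \int[lebesgue_measure]_(x in `[- 2^-1, 2^-1]%classic) (p * q).[x].
Proof. by apply: eq_Rintegral => x _; rewrite hornerM. Qed.

Lemma innerC p q : inner p q = inner q p.
Proof. by rewrite !innerE mulrC. Qed.

Lemma innerDl p q r : inner (p + q) r = inner p r + inner q r.
Proof.
rewrite !innerE mulrDl -RintegralD //; try exact: integrable_horner.
by apply: eq_Rintegral => x _; rewrite hornerD.
Qed.

Lemma innerZl a p q : inner (a *: p) q = a * inner p q.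
Proof.
rewrite !innerE -scalerAl -RintegralZl //; last exact: integrable_horner.
by apply: eq_Rintegral => x _; rewrite hornerZ.
Qed.

Lemma inner_suml (I : finType) (f : I -> {poly R}) q :
  inner (\sum_i f i) q = \sum_i inner (f i) q.
Proof.
apply: (big_morph (fun p => inner p q)); first by move=> p r; exact: innerDl.
by rewrite -(scale0r 0) innerZl mul0r.
Qed.

(** Product rule and fundamental theorem of calculus on the reference cell. *)
Lemma inner_deriv p q : inner p^`() q + inner p q^`() =
  p.[2^-1] * q.[2^-1] - p.[- 2^-1] * q.[- 2^-1].
Proof.
rewrite !innerE -!hornerM -Defs.integral_poly derivM -RintegralD //;
  try exact: integrable_horner.
by apply: eq_Rintegral => x _; rewrite hornerD.
Qed.

Lemma orthonormal_basisW (K n : nat) (b : nat -> {poly R}) :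
  (n <= K)%N -> orthonormal_basis K b -> orthonormal_basis n b.
Proof.
move=> nK [hs ho]; split=> [k kn|k l kn ln]; first exact/hs/(leq_trans kn).
by apply: ho; [exact: leq_trans kn _ | exact: leq_trans ln _].
Qed.

Section Basis.
Variables (K : nat) (b : nat -> {poly R}).
Hypothesis hb : orthonormal_basis K b.

(** Induction on the degree: subtracting the multiple [d] of [b n] that cancels the top coefficient
    lowers the degree. The bound is [K.+1] because a size exceeds the degree by one. *)
Lemma orthonormal_basis_span n q : (n <= K.+1)%N -> (size q <= n)%N ->
  exists c : 'I_n -> R, q = \sum_i c i *: b i.
Proof.
elim: n q => [|n IHn] q nK sq.
  by exists (fun=> 0); rewrite big_ord0; apply/eqP; rewrite -size_poly_eq0 -leqn0.
have [sb lb] := hb.1 n nK.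
set d := q`_n / lead_coef (b n).
have sr : (size (q - d *: b n)%R <= n)%N.
  apply/leq_sizeP => j; rewrite leq_eqVlt coefB coefZ => /predU1P[<-|nj].
    have -> : (b n)`_n = lead_coef (b n) by rewrite lead_coefE sb.
    by rewrite divfK ?subrr // gt_eqF.
  by rewrite !nth_default ?mulr0 ?subr0 ?sb // (leq_trans sq).
have [c qc] := IHn _ (ltnW nK) sr.
exists (fun i => if unlift ord_max i is Some j then c j else d).
rewrite big_ord_recr /= unlift_none -[q in LHS](subrK (d *: b n)) qc.
congr (_ + _); apply: eq_bigr => i _.
have -> : widen_ord (leqnSn n) i = lift ord_max i.
  by apply/val_inj; rewrite /= /bump leqNgt ltn_ord.
by rewrite liftK.
Qed.

Lemma orthonormal_basis_orthogonal k q :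
  (k <= K)%N -> (size q <= k)%N -> inner (b k) q = 0.
Proof.
move=> kK sq; have [c ->] := @orthonormal_basis_span k q (leqW kK) sq.
rewrite innerC inner_suml big1 // => i _; rewrite innerZl hb.2 //; last first.
  exact: leq_trans (ltnW (ltn_ord i)) kK.
by rewrite ltn_eqF ?mulr0.
Qed.

End Basis.

(** The remainder of [b' k] after removing [c *: b k] has degree below [k], yet is orthogonal to all
    lower basis functions, so it vanishes. Normalization then gives [c ^+ 2 = 1], and the positive
    leading coefficients select [c = 1]. *)
Lemma orthonormal_basis_unique (K : nat) (b b' : nat -> {poly R}) k :
  orthonormal_basis K b -> orthonormal_basis K b' -> (k <= K)%N -> b k = b' k.
Proof.
move=> hb hb' kK; have [sb lb] := hb.1 k kK; have [sb' lb'] := hb'.1 k kK.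
set c := lead_coef (b' k) / lead_coef (b k).
have c0 : 0 < c by rewrite divr_gt0.
have sd : (size (b' k + - c *: b k)%R <= k)%N.
  apply/leq_sizeP => j; rewrite leq_eqVlt coefD coefZ mulNr => /predU1P[<-|kj].
    have e (p : {poly R}) : size p = k.+1 -> p`_k = lead_coef p.
      by rewrite lead_coefE => ->.
    by rewrite !e // divfK ?subrr // gt_eqF.
  by rewrite !nth_default ?mulr0 ?subr0 ?sb ?sb'.
have [a ea] := @orthonormal_basis_span _ _ hb k _ (leqW kK) sd.
have a0 i : a i = 0.
  have iK : (i <= K)%N by exact: leq_trans (ltnW (ltn_ord i)) kK.
  have : inner (b' k + - c *: b k) (b i) = a i.
    rewrite ea inner_suml (bigD1 i) //= innerZl hb.2 // eqxx mulr1.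
    rewrite big1 ?addr0 // => j ji; rewrite innerZl hb.2 //.
      by rewrite val_eqE (negPf ji) mulr0.
    exact: leq_trans (ltnW (ltn_ord j)) kK.
  have si : (size (b i) <= k)%N by rewrite (hb.1 i iK).1.
  rewrite innerDl innerZl.
  rewrite (orthonormal_basis_orthogonal hb) //.
  by rewrite (orthonormal_basis_orthogonal hb') // mulr0 addr0.
have e : b' k = c *: b k.
  apply/eqP; rewrite -subr_eq0 -scaleNr ea big1 // => i _.
  by rewrite a0 scale0r.
have := hb'.2 k k kK kK; rewrite eqxx e innerZl innerC innerZl hb.2 // eqxx mulr1.
move=> /eqP; rewrite -expr2 sqrf_eq1 => /orP[/eqP ->|/eqP c1].
  by rewrite scale1r.
by move: c0; rewrite c1 oppr_gt0 ltr10.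
Qed.

Lemma orthonormal_basis_legendre (K : nat) (b : nat -> {poly R}) k :
  (K <= 2)%N -> orthonormal_basis K b -> (k <= K)%N -> b k = legendre012 R k.
Proof.
move=> K2 hb; apply: orthonormal_basis_unique hb _.
exact: orthonormal_basisW K2 (orthonormal_basis_legendre012 R).
Qed.

End InnerProduct.

(** * Bounds on the kernel dimension *)

Section KernelDimension.
Variables (F : fieldType) (n : nat) (A : 'M[F]_n).

Lemma dim_ker_gt0 (v : 'cV[F]_n) : v != 0 -> A *m v = 0 -> (0 < dim_ker A)%N.
Proof.
move=> v0 Av; rewrite /dim_ker mxrank_coker lt0n subn_eq0 -ltnNge ltn_neqAle.
rewrite rank_leq_row andbT; apply: contra v0 => fr.
have Au : A \in unitmx by rewrite -row_free_unit.
by rewrite -(mulKmx Au v) Av mulmx0.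
Qed.

(** The columns of [cokermx A] are kernel vectors and so lie in the column span of [W]; after
    transposition this is an inclusion of row spaces, which bounds the rank. *)
Lemma dim_ker_le (m : nat) (W : 'M[F]_(n, m)) :
  (forall v : 'cV[F]_n, A *m v = 0 -> exists c : 'cV[F]_m, v = W *m c) ->
  (dim_ker A <= m)%N.
Proof.
move=> h; rewrite /dim_ker -mxrank_tr -mxrank_tr -[leqRHS]/(m).
apply: leq_trans (rank_leq_row W^T); rewrite trmxK -mxrank_tr.
apply: mxrankS; apply/row_subP => i; rewrite -tr_col.
have [|c ->] := h (col i (cokermx A)); last by rewrite trmx_mul submxMl.
by rewrite colE mulmxA mulmx_coker mul0mx.
Qed.

Lemma dim_ker_eq0 : (forall v : 'cV[F]_n, A *m v = 0 -> v = 0) -> dim_ker A = 0%N.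
Proof.
move=> h; apply/eqP; rewrite -leqn0; apply: (@dim_ker_le 0 0) => v /h ->.
by exists 0; rewrite mulmx0.
Qed.

End KernelDimension.

(** * Conjugate transpose and Frobenius norm *)

Section Adjoint.
Variable R : realType.
Notation C := R[i].

Definition adjmx m n (A : 'M[C]_(m, n)) : 'M[C]_(n, m) :=
  map_mx (@conjc R) A^T.

Lemma adjmxM m n p (A : 'M[C]_(m, n)) (B : 'M[C]_(n, p)) :
  adjmx (A *m B) = adjmx B *m adjmx A.
Proof. by rewrite /adjmx trmx_mul map_mxM. Qed.

Lemma adjmxK m n (A : 'M[C]_(m, n)) : adjmx (adjmx A) = A.
Proof. by apply/matrixP => i j; rewrite !mxE conjcK. Qed.

Lemma mxtrace_adj n (A : 'M[C]_n) : \tr (adjmx A) = conjc (\tr A).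
Proof. by rewrite rmorph_sum; apply: eq_bigr => i _; rewrite !mxE. Qed.

(** The squared Frobenius norm, which serves as the energy of a field. *)
Lemma mxtrace_mul_adj m n (A : 'M[C]_(m, n)) :
  \tr (A *m adjmx A) = \sum_i \sum_j `|A i j| ^+ 2.
Proof.
by apply: eq_bigr => i _; rewrite mxE; apply: eq_bigr => j _; rewrite !mxE sqr_normc.
Qed.

Lemma mxtrace_mul_adj_ge0 m n (A : 'M[C]_(m, n)) : 0 <= \tr (A *m adjmx A).
Proof.
by rewrite mxtrace_mul_adj; do 2 (apply: sumr_ge0 => ? _); rewrite exprn_ge0.
Qed.

Lemma mxtrace_mul_adj_eq0 m n (A : 'M[C]_(m, n)) : \tr (A *m adjmx A) = 0 -> A = 0.
Proof.
rewrite mxtrace_mul_adj => /eqP.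
rewrite psumr_eq0; last by move=> i _; apply: sumr_ge0 => j _; rewrite exprn_ge0.
move=> /allP h; apply/matrixP => i j; rewrite mxE.
have := h i; rewrite mem_index_enum => /(_ isT) /=.
rewrite psumr_eq0; last by move=> k _; rewrite exprn_ge0.
move=> /allP /(_ j); rewrite mem_index_enum => /(_ isT) /=.
by rewrite sqrf_eq0 normr_eq0 => /eqP.
Qed.

Lemma conjc_ge0 (x : C) : 0 <= x -> conjc x = x.
Proof. by case: x => a c /=; rewrite lecE /= => /andP[/eqP-> _]; rewrite oppr0. Qed.

(** * The energy argument for a skew-Hermitian operator with jump dissipation *)

Section Energy.
Variables (n : nat) (Nx Ny : 'M[C]_n) (jx jy : 'rV[C]_n) (ax ay : C).
Hypotheses (skx : adjmx Nx = - Nx) (sky : adjmx Ny = - Ny).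
Hypotheses (ax0 : 0 < ax) (ay0 : 0 < ay).

(** [X] holds tensor-product coefficients, rows for the modes in x and columns for those in y;
    operators in y therefore act from the right, transposed. *)
Definition dissipation (X : 'M[C]_n) : 'M[C]_n :=
  ax *: (adjmx jx *m (jx *m X)) + ay *: (X *m jy^T *m adjmx jy^T).

(** By cyclicity of the trace, the dissipated energy is a weighted sum of squared norms of the jumps
    in x and in y. *)
Lemma mxtrace_dissipation X : \tr (dissipation X *m adjmx X) =
  ax * \tr (jx *m X *m adjmx (jx *m X)) + ay * \tr (X *m jy^T *m adjmx (X *m jy^T)).
Proof.
rewrite mulmxDl mxtraceD -!scalemxAl !mxtraceZ !adjmxM.
by rewrite -mulmxA mxtrace_mulC !mulmxA.
Qed.

Lemma mxtrace_dissipation_ge0 X : 0 <= \tr (dissipation X *m adjmx X).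
Proof.
by rewrite mxtrace_dissipation addr_ge0 ?mulr_ge0 ?mxtrace_mul_adj_ge0 ?ltW.
Qed.

Lemma mxtrace_dissipation_eq0 X : \tr (dissipation X *m adjmx X) = 0 ->
  jx *m X = 0 /\ X *m jy^T = 0.
Proof.
rewrite mxtrace_dissipation => /eqP.
rewrite paddr_eq0 ?mulr_ge0 ?mxtrace_mul_adj_ge0 ?(ltW ax0) ?(ltW ay0) //.
rewrite !mulf_eq0 (gt_eqF ax0) (gt_eqF ay0) => /andP[/eqP h1 /eqP h2].
by split; apply: mxtrace_mul_adj_eq0.
Qed.

(* Tested against (U, V, P), the skew-Hermitian central part contributes
   nothing to the real part, which is thus the sum of the dissipations. *)
Lemma dissipation_eq0 (cx cy : C) (U V P : 'M[C]_n) :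
  conjc cx = cx -> conjc cy = cy ->
  cx *: (Nx *m P) + dissipation U = 0 ->
  cy *: (P *m Ny^T) + dissipation V = 0 ->
  cx *: (Nx *m U) + cy *: (V *m Ny^T) + dissipation P = 0 ->
  [/\ jx *m U = 0 /\ U *m jy^T = 0, jx *m V = 0 /\ V *m jy^T = 0
    & jx *m P = 0 /\ P *m jy^T = 0].
Proof.
move=> cxr cyr.
have := @mxtrace_dissipation_eq0 U; have := mxtrace_dissipation_ge0 U.
have := @mxtrace_dissipation_eq0 V; have := mxtrace_dissipation_ge0 V.
have := @mxtrace_dissipation_eq0 P; have := mxtrace_dissipation_ge0 P.
move: (dissipation U) (dissipation V) (dissipation P) => SU SV SP p0 hp v0 hv u0 hu.
move=> /(congr1 (fun M => \tr (M *m adjmx U))) /= e1.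
move=> /(congr1 (fun M => \tr (M *m adjmx V))) /= e2.
move=> /(congr1 (fun M => \tr (M *m adjmx P))) /= e3.
move: e1 e2 e3; rewrite !mulmxDl !mxtraceD !mul0mx !mxtrace0 -!scalemxAl !mxtraceZ.
(* Skewness: the work of the divergence against the pressure is minus the conjugate of the work of
   the pressure gradient against the velocity. *)
have -> : \tr (Nx *m U *m adjmx P) = - conjc (\tr (Nx *m P *m adjmx U)).
  rewrite -mxtrace_adj !adjmxM adjmxK skx !mulmxN linearN opprK /=.
  by rewrite mulmxA [RHS]mxtrace_mulC mulmxA.
have -> : \tr (V *m Ny^T *m adjmx P) = - conjc (\tr (P *m Ny^T *m adjmx V)).
  rewrite -mxtrace_adj !adjmxM adjmxK.
  have -> : adjmx Ny^T = - Ny^T.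
    by rewrite -linearN -sky; apply/matrixP => i j; rewrite !mxE.
  by rewrite mulNmx mulmxN linearN opprK /= mulmxA.
move: (\tr (SU *m _)) (\tr (SV *m _)) (\tr (SP *m _)) p0 hp v0 hv u0 hu.
move=> u v p p0 hp v0 hv u0 hu.
set m1 := \tr (Nx *m P *m _); set m2 := \tr (P *m Ny^T *m _) => g1 g2 g3.
(* [u] and [v] are nonnegative, hence real, so the first two equations can be conjugated. Inserted
   in the third they give [u + v + p = 0], a vanishing sum of nonnegative terms. *)
have g1' : cx * conjc m1 = - u.
  by rewrite -cxr -rmorphM -[u]conjc_ge0 // -rmorphN; congr conjc; apply/eqP; rewrite -addr_eq0 g1.
have g2' : cy * conjc m2 = - v.
  by rewrite -cyr -rmorphM -[v]conjc_ge0 // -rmorphN; congr conjc; apply/eqP; rewrite -addr_eq0 g2.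
move: g3; rewrite !mulrN g1' g2' !opprK => /eqP.
rewrite !paddr_eq0 ?addr_ge0 // => /andP[/andP[/eqP z1 /eqP z2] /eqP z3].
by split; auto.
Qed.

End Energy.
End Adjoint.

(** * The evolution matrix as one-dimensional operators on coefficient matrices *)

Lemma mul_mxblock_mxcol (R : pzSemiRingType) p q (p_ : 'I_p -> nat) (q_ : 'I_q -> nat) m
    (B : forall i j, 'M[R]_(p_ i, q_ j)) (A : forall j, 'M[R]_(q_ j, m)) :
  (\mxblock_(i, j) B i j) *m (\mxcol_j A j) = \mxcol_i \sum_j (B i j *m A j).
Proof.
by rewrite mxblockEv mxcol_mul; apply: eq_mxcol => i; rewrite mul_mxrow_mxcol.
Qed.

Section Discretization.
Variable R : realType.
Notation C := R[i].
Local Open Scope complex_scope.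

Lemma phase_neq0 (x : R) : phase x != 0.
Proof.
apply/negP => /eqP; rewrite /phase => -[c s]; have := cos2Dsin2 x.
by rewrite c s expr0n addr0 => /eqP; rewrite eq_sym oner_eq0.
Qed.

Lemma conj_phase (x : R) : conjc (phase x) = (phase x)^-1.
Proof.
apply: (mulfI (phase_neq0 x)); rewrite mulfV ?phase_neq0 // /phase /=.
by apply/eqP; rewrite eq_complex /=; apply/andP; split; apply/eqP;
  [rewrite -(cos2Dsin2 x); ring | ring].
Qed.

Variables (K : nat) (b : nat -> {poly R}).
Notation n := K.+1.
Implicit Types (t s : C) (U V P X : 'M[C]_n).

(** Right trace in a cell minus left trace in the next cell, whose coefficients carry the phase
    factor [t]. *)
Definition jump t : 'rV[C]_n := \row_a (bR b a - t * bL b a).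

(** The derivative falls on the test function [k], so it is the transpose that represents
    differentiation in the orthonormal basis. *)
Definition stiffness : 'M[C]_n := \matrix_(k, a) stiffC b k a.

(** The one-dimensional operator with the averaged flux, without diffusion and without the factor of
    the grid spacing. *)
Definition central t : 'M[C]_n :=
  \matrix_(k, a) ((bR b k - t^-1 * bL b k) * ((bR b a + t * bL b a) / 2) - stiffC b k a).

Lemma stiffC_swap k a : stiffC b k a = bR b k * bR b a - bL b k * bL b a - stiffC b a k.
Proof.
apply/eqP; rewrite eq_sym subr_eq /stiffC [inner (b a)^`() _]innerC.
by rewrite -rmorphD /= inner_deriv rmorphB !rmorphM.
Qed.

Lemma conjcD (x y : C) : conjc (x + y) = conjc x + conjc y.
Proof. exact: rmorphD. Qed.

Lemma conjcN (x : C) : conjc (- x) = - conjc x.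
Proof. exact: rmorphN. Qed.

Lemma conjcM (x y : C) : conjc (x * y) = conjc x * conjc y.
Proof. exact: rmorphM. Qed.

Lemma conjc_trace k :
  (conjc (bR b k) = bR b k) * (conjc (bL b k) = bL b k).
Proof. by rewrite /bR /bL !conjc_real. Qed.

Definition conjcE := (conjc_nat, conjcN, conjc_inv, conjcM, conjcD, conjc_trace).

(** The terms coupling neighbouring cells cancel against those of the adjoint because [t] has
    modulus 1; the remaining traces cancel the symmetric part of the stiffness, by integration by
    parts. *)
Lemma central_skew t : t != 0 -> conjc t = t^-1 -> adjmx (central t) = - central t.
Proof.
move=> t0 ct; apply/matrixP => k a; rewrite !mxE stiffC_swap.
rewrite !conjcE ct invrK [conjc (stiffC _ _ _)]conjc_real; field.
exact: t0.
Qed.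

(** The central operator differs from differentiation by a rank-one matrix that factors through
    [jump t]. *)
Lemma central_jump0 t X : t != 0 -> jump t *m X = 0 ->
  central t *m X = stiffness^T *m X.
Proof.
move=> t0 jX.
pose m : 'cV[C]_n := \col_k (bR b k + t^-1 * bL b k).
have -> : central t = stiffness^T - 2^-1 *: (m *m jump t).
  apply/matrixP => k a; rewrite !mxE big_ord1 !mxE stiffC_swap; field.
  exact: t0.
by rewrite mulmxBl -scalemxAl -mulmxA jX mulmx0 scaler0 subr0.
Qed.

(** Entry [(k, l)] of each matrix is the coefficient of [b k] in x times [b l] in y; the nested
    columns match the mode ordering of [evolution_matrix]. *)
Definition fields U V P : 'cV[C]_(\sum_(k < n) \sum_(l < n) 3) :=
  \mxcol_(k < n) \mxcol_(l < n) \col_i nth 0 [:: U k l; V k l; P k l] i.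

Lemma fieldsP (v : 'cV[C]_(\sum_(k < n) \sum_(l < n) 3)) :
  exists U V P, v = fields U V P.
Proof.
pose M i : 'M[C]_n := \matrix_(k, l) submxcol (submxcol v k) l i 0.
exists (M 0), (M 1), (M 2%:R); rewrite -[LHS]submxcolK; apply: eq_mxcol => k.
rewrite -[LHS]submxcolK; apply: eq_mxcol => l.
apply/matrixP => i j; rewrite ord1 [RHS]mxE.
case: i => [[|[|[|//]]] h]; rewrite /= [RHS]mxE; congr (fun_of_matrix _ _ _);
  exact: val_inj.
Qed.

Lemma fields_inj U V P U' V' P' : fields U V P = fields U' V' P' ->
  [/\ U = U', V = V' & P = P'].
Proof.
move=> e; have h k l i : nth 0 [:: U k l; V k l; P k l] (i : 'I_3) =
    nth 0 [:: U' k l; V' k l; P' k l] i.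
  have := congr1 (fun w => submxcol (submxcol w k) l i 0) e.
  by rewrite /fields !mxcolK !mxE.
by split; apply/matrixP => k l; [have := h k l 0 | have := h k l 1 | have := h k l 2%:R].
Qed.

Lemma fields0 : fields 0 0 0 = 0.
Proof.
rewrite -[RHS]mxcol0; apply: eq_mxcol => k; rewrite -[RHS]mxcol0; apply: eq_mxcol => l.
by apply/matrixP => -[[|[|[|//]]] h] j; rewrite !mxE.
Qed.

Lemma fieldsZ c U V P : fields (c *: U) (c *: V) (c *: P) = c *: fields U V P.
Proof.
apply/matrixP => i j; rewrite !mxE.
by case: (tagnat.sig2 (tagnat.sig2 i)) => [[|[|[|//]]] h].
Qed.

(** The diffusive flux is half the jump of the unknown, and its test factor is the conjugate jump
    because [t] has modulus 1. With identity diffusion this yields the scalar block with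
    [jump^* jump / 2]. *)
Lemma flux_mode_block (J : 'M[C]_3) (m t h : C) (k a : 'I_n) :
  t != 0 -> conjc t = t^-1 -> h != 0 ->
  - (h^-1 * m * stiffC b k a) *: J
    + ((bR b k * t - bL b k) / (t * h) * m) *: flux_mode b J 1%:M t a =
  (h^-1 * m * central t k a) *: J
    + (h^-1 / 2 * m * (adjmx (jump t) *m jump t) k a)%:M.
Proof.
move=> t0 ct h0; rewrite /flux_mode scalerBr !scalerA addrA -scalerDl -scaleNr.
rewrite scalemx1; congr (_ *: J + _%:M); rewrite !mxE ?big_ord1 ?mxE.
  by field; rewrite t0 h0.
by rewrite !conjcE ct; field; rewrite t0 h0.
Qed.

Lemma acoustics_block_mul (x y z u v p : C) :
  (x *: Jx R + y *: Jy R + z%:M) *m (\col_(i < 3) nth 0 [:: u; v; p] i) =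
  \col_i nth 0 [:: x * p + z * u; y * p + z * v; x * u + y * v + z * p] i.
Proof.
apply/matrixP => i j; rewrite !mxE !big_ord_recl big_ord0 !mxE.
by case: i => [[|[|[|//]]] h]; rewrite /= ?mulr1n ?mulr0n; ring.
Qed.

Section Evolution.
Variables dx dy kx ky : R.
Hypotheses (hb : orthonormal_basis K b) (dx0 : 0 < dx) (dy0 : 0 < dy).
Let tx := phase (kx * dx).
Let ty := phase (ky * dy).
Let ax : C := (dx%:C)^-1.
Let ay : C := (dy%:C)^-1.
Let S := dissipation (jump tx) (jump ty) (ax / 2) (ay / 2).

Lemma rusanov_evolution_fields U V P :
  rusanov_evolution_matrix b dx dy K kx ky *m fields U V P =
  fields (ax *: (central tx *m P) + S U)
         (ay *: (P *m (central ty)^T) + S V)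
         (ax *: (central tx *m U) + ay *: (V *m (central ty)^T) + S P).
Proof.
have dxn : dx%:C != 0 by rewrite fmorph_eq0 gt_eqF.
have dyn : dy%:C != 0 by rewrite fmorph_eq0 gt_eqF.
rewrite /rusanov_evolution_matrix /evolution_matrix mul_mxblock_mxcol.
apply: eq_mxcol => k; etransitivity.
  by apply: eq_bigr => a _; exact: mul_mxblock_mxcol.
rewrite -mxcol_sum; apply: eq_mxcol => l.
have massE (i j : 'I_n) : massC b i j = (i == j)%:R.
  by rewrite /massC hb.2 ?leq_ord // val_eqE; case: (i == j).
have pick (i : 'I_n) (f : 'I_n -> C) : \sum_j (i == j)%:R * f j = f i.
  rewrite (bigD1 i) //= eqxx mul1r big1 ?addr0 // => j ji.
  by rewrite eq_sym (negPf ji) mul0r.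
pose bk (a c : 'I_n) : 'M[C]_3 := (ax * (l == c)%:R * central tx k a) *: Jx R
  + (ay * (k == a)%:R * central ty l c) *: Jy R
  + (ax / 2 * (l == c)%:R * (adjmx (jump tx) *m jump tx) k a
     + ay / 2 * (k == a)%:R * ((jump ty)^T *m adjmx (jump ty)^T) c l)%:M.
have blockE (a c : 'I_n) : evolution_block b dx dy 1%:M 1%:M kx ky k l a c = bk a c.
  rewrite /evolution_block /bk !massE.
  have -> : ((jump ty)^T *m adjmx (jump ty)^T) c l = (adjmx (jump ty) *m jump ty) l c.
    by rewrite !mxE !big_ord1 !mxE mulrC.
  rewrite [(_ + _)%:M]raddfD /= [RHS]addrACA /ax /ay /tx /ty.
  rewrite -(flux_mode_block _ _ _ _ (phase_neq0 _) (conj_phase _) dxn).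
  rewrite -(flux_mode_block _ _ _ _ (phase_neq0 _) (conj_phase _) dyn).
  by rewrite [RHS]addrACA [RHS]addrA !scaleNr.
(* The identity mass matrix in the other direction collapses the double sum to a left product for x
   and, in [sumy], a right product for y. *)
have sumx (c : C) (M : 'M[C]_n) X : \sum_a \sum_d (c * (l == d)%:R * M k a) * X a d = c * (M *m X) k l.
  rewrite mxE mulr_sumr; apply: eq_bigr => a _.
  rewrite -[RHS](pick l (fun d => c * (M k a * X a d))).
  by apply: eq_bigr => d _; ring.
have sumy (c : C) (M : 'M[C]_n) X : \sum_a \sum_d (c * (k == a)%:R * M d l) * X a d = c * (X *m M) k l.
  rewrite mxE mulr_sumr exchange_big; apply: eq_bigr => d _.
  rewrite -[RHS](pick k (fun a => c * (X a d * M d l))).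
  by apply: eq_bigr => a _; ring.
have dissipE X : S X k l =
    ax / 2 * (adjmx (jump tx) *m jump tx *m X) k l +
    ay / 2 * (X *m ((jump ty)^T *m adjmx (jump ty)^T)) k l.
  by rewrite /S /dissipation !mulmxA [LHS]mxE; congr (_ + _); rewrite mxE.
apply/matrixP => i j; rewrite ord1 summxE.
under eq_bigr do rewrite summxE.
under eq_bigr do under eq_bigr do rewrite blockE acoustics_block_mul mxE.
rewrite [RHS]mxE; case: i => [[|[|[|//]]] hi] /=.
- rewrite [RHS]mxE [X in _ = X + _]mxE dissipE -sumx -sumx -sumy.
  rewrite -!big_split; apply: eq_bigr => a _; rewrite -!big_split; apply: eq_bigr => c _.
  by rewrite mulrDl.
- rewrite [RHS]mxE [X in _ = X + _]mxE dissipE -sumy -sumx -sumy.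
  rewrite -!big_split; apply: eq_bigr => a _; rewrite -!big_split; apply: eq_bigr => c _.
  by rewrite mulrDl [(central ty)^T _ _]mxE.
rewrite [RHS]mxE [X in _ = X + _]mxE [X in _ = X + _ + _]mxE [X in _ = _ + X + _]mxE.
rewrite dissipE -sumx -sumy -sumx -sumy.
rewrite -!big_split; apply: eq_bigr => a _; rewrite -!big_split; apply: eq_bigr => c _.
by rewrite mulrDl [(central ty)^T _ _]mxE.
Qed.
End Evolution.
End Discretization.

(** * Characterization of the kernel *)

Section Kernel.
Variable R : realType.
Notation C := R[i].
Local Open Scope complex_scope.
Variables (K : nat) (b : nat -> {poly R}) (dx dy : R).
Notation n := K.+1.
Hypotheses (hb : orthonormal_basis K b) (dx0 : 0 < dx) (dy0 : 0 < dy).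

Definition continuous_modes (t s : C) (X : 'M[C]_n) : Prop :=
  jump K b t *m X = 0 /\ X *m (jump K b s)^T = 0.

(* The kernel consists of the globally continuous (Bloch-periodic) fields that
   are exactly stationary: vanishing pressure gradient and divergence. *)
Lemma rusanov_kernelP (kx ky : R) (U V P : 'M[C]_n) :
  let t := phase (kx * dx) in
  let s := phase (ky * dy) in
  let D := (stiffness K b)^T in
  rusanov_evolution_matrix b dx dy K kx ky *m fields U V P = 0 <->
  [/\ [/\ continuous_modes t s U, continuous_modes t s V & continuous_modes t s P],
      D *m P = 0, P *m D^T = 0 &
      (dx%:C)^-1 *: (D *m U) + (dy%:C)^-1 *: (V *m D^T) = 0].
Proof.
move=> t s D; rewrite trmxK rusanov_evolution_fields //.
have [t0 s0] : t != 0 /\ s != 0 by rewrite !phase_neq0.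
have [tc sc] : conjc t = t^-1 /\ conjc s = s^-1 by rewrite !conj_phase.
have ax0 : (dx%:C)^-1 != 0 by rewrite invr_neq0 // fmorph_eq0 gt_eqF.
have ay0 : (dy%:C)^-1 != 0 by rewrite invr_neq0 // fmorph_eq0 gt_eqF.
have axp : 0 < (dx%:C)^-1 / 2 by rewrite divr_gt0 // invr_gt0 ltcR.
have ayp : 0 < (dy%:C)^-1 / 2 by rewrite divr_gt0 // invr_gt0 ltcR.
have Dx (X : 'M[C]_n) : jump K b t *m X = 0 -> central K b t *m X = D *m X by exact: central_jump0.
have Dy (X : 'M[C]_n) : X *m (jump K b s)^T = 0 -> X *m (central K b s)^T = X *m stiffness K b.
  move=> Xs; apply: trmx_inj; rewrite !trmx_mul trmxK central_jump0 //.
  by apply: trmx_inj; rewrite trmx_mul trmxK Xs trmx0.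
(* The converse comes first: without jumps the dissipation vanishes and the central operators are
   plain derivatives. *)
split=> [|[[[tU Us] [tV Vs] [tP Ps]] gx gy dv]]; last first.
  have S0 (X : 'M[C]_n) : jump K b t *m X = 0 -> X *m (jump K b s)^T = 0 ->
      dissipation (jump K b t) (jump K b s) ((dx%:C)^-1 / 2) ((dy%:C)^-1 / 2) X = 0.
    by rewrite /dissipation => -> ->; rewrite mulmx0 mul0mx !scaler0 addr0.
  by rewrite !S0 // !Dx // !Dy // gx gy dv !scaler0 !addr0 fields0.
rewrite -[RHS]fields0 => /fields_inj [e1 e2 e3].
(* The energy argument removes all jumps, after which the three equations contain derivatives
   only. *)
have [||||[tU Us] [tV Vs] [tP Ps]] := dissipation_eq0 _ _ axp ayp _ _ e1 e2 e3.
- exact: central_skew.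
- exact: central_skew.
- by rewrite conjc_inv conjc_real.
- by rewrite conjc_inv conjc_real.
move: e1 e2 e3; rewrite !Dx // !Dy // /dissipation tU tV tP Us Vs Ps.
rewrite !mulmx0 !mul0mx !scaler0 !addr0 => /eqP + /eqP.
rewrite !scaler_eq0 (negPf ax0) (negPf ay0) /= => /eqP gx /eqP gy dv.
by split.
Qed.

End Kernel.

(** * Explicit traces and stiffness entries up to degree 2 *)

Section Legendre.
Variable R : realType.
Notation C := R[i].
Local Open Scope complex_scope.
Let s3 : C := (Num.sqrt 3)%:C.
Let s5 : C := (Num.sqrt 5)%:C.
Variables (K : nat) (b : nat -> {poly R}).
Hypotheses (K2 : (K <= 2)%N) (hb : orthonormal_basis K b).

Lemma bR_legendre k : (k <= K)%N -> bR b k = nth 0 [:: 1; s3; s5] k.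
Proof.
move=> kK; rewrite /bR (orthonormal_basis_legendre K2 hb kK).
move: k {kK} (leq_trans kK K2) => [|[|[|//]]] _; rewrite /legendre012 /= ?hornerE //.
  by congr (_%:C) => /=; field.
by congr (_%:C) => /=; field.
Qed.

Lemma bL_legendre k : (k <= K)%N -> bL b k = nth 0 [:: 1; - s3; s5] k.
Proof.
move=> kK; rewrite /bL (orthonormal_basis_legendre K2 hb kK).
move: k {kK} (leq_trans kK K2) => [|[|[|//]]] _; rewrite /legendre012 /= ?hornerE //.
  by rewrite -rmorphN; congr (_%:C) => /=; field.
by congr (_%:C) => /=; field.
Qed.

(** Each derivative is a multiple of the preceding basis function: [2 * s3] times [b 0] for [b 1],
    and [2 * s3 * s5] times [b 1] for [b 2]. *)
Lemma stiffC_legendre k a : (k <= K)%N -> (a <= K)%N ->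
  stiffC b k a = (k == a.+1)%:R * nth 0 [:: 0; 2 * s3; 2 * s3 * s5] k.
Proof.
move=> kK aK; rewrite /stiffC.
have db : (b k)^`() = nth 0 [:: 0; (2 * Num.sqrt 3) *: b 0;
    (2 * Num.sqrt 3 * Num.sqrt 5) *: b 1%N] k.
  rewrite (orthonormal_basis_legendre K2 hb kK).
  rewrite (orthonormal_basis_legendre K2 hb (leq0n _)).
  case: k kK => [|[|[|k]]] kK /=.
  - by rewrite /legendre012 /= -polyC1 derivC.
  - by rewrite /legendre012 /= derivZ derivX.
  - rewrite (orthonormal_basis_legendre K2 hb (ltnW kK)) /legendre012 /=.
    rewrite derivZ derivB derivZ derivXn -polyC1 derivC subr0 /= !scalerA.
    rewrite -['X^1 *+ 2]scaler_nat scalerA expr1; congr (_ *: _).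
    have q3 : Num.sqrt (3 : R) ^+ 2 = 3 by rewrite sqr_sqrtr.
    by transitivity (4 * Num.sqrt 3 ^+ 2 * Num.sqrt 5 : R); [rewrite q3; field | ring].
  - by have := leq_trans kK K2.
rewrite db; case: k kK {db} => [|[|[|k]]] kK /=.
- by rewrite mulr0 -(scale0r 0) innerZl mul0r.
- rewrite innerZl hb.2 //; rewrite mulrC rmorphM eqSS /=.
  by congr (_ * _); [case: eqP | rewrite rmorphM rmorph_nat].
- rewrite innerZl hb.2 ?(ltnW kK) // mulrC rmorphM !eqSS /=.
  by congr (_ * _); [case: eqP | rewrite !rmorphM rmorph_nat].
by have := leq_trans kK K2.
Qed.

End Legendre.

(** * Kernels for degrees 0, 1 and 2 *)

Section LowDegree.
Variable R : realType.
Notation C := R[i].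
Local Open Scope complex_scope.
Let s3 : C := (Num.sqrt 3)%:C.
Let s5 : C := (Num.sqrt 5)%:C.
Variables (b : nat -> {poly R}) (dx dy : R).
Hypotheses (dx0 : 0 < dx) (dy0 : 0 < dy).
(** With [ky], the wave vector at which both phases are -1. Antiperiodicity excludes nonzero
    constants, and the minimum is attained here for each degree up to 2. *)
Let kx := pi / dx.
Let ky := pi / dy.

Let s30 : s3 != 0. Proof. by rewrite fmorph_eq0 gt_eqF ?sqrtr_gt0. Qed.
Let s50 : s5 != 0. Proof. by rewrite fmorph_eq0 gt_eqF ?sqrtr_gt0. Qed.
Let dxn : dx%:C != 0. Proof. by rewrite fmorph_eq0 gt_eqF. Qed.
Let dyn : dy%:C != 0. Proof. by rewrite fmorph_eq0 gt_eqF. Qed.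

Lemma phase_pi (x : R) : 0 < x -> phase (pi / x * x) = -1.
Proof.
move=> x0; rewrite divfK ?gt_eqF // /phase cospi sinpi.
by apply/eqP; rewrite eq_complex /= oppr0 !eqxx.
Qed.

(** At phase -1 the two traces add up: they double for even basis functions and cancel for odd
    ones. *)
Lemma jump_antiperiodic K a : (K <= 2)%N -> orthonormal_basis K b ->
  jump K b (-1) 0 a = nth 0 [:: 2; 0; 2 * s5] a.
Proof.
move=> K2 hb; have aK := leq_ord a; rewrite mxE (bR_legendre K2) // (bL_legendre K2) //.
rewrite -/s3 -/s5; case: a aK => [[|[|[|a]]] ha] aK /=; try ring.
by have := leq_trans aK K2.
Qed.

Lemma rusanov_dim_ker0 : orthonormal_basis 0 b ->
  dim_ker (rusanov_evolution_matrix b dx dy 0 kx ky) = 0%N.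
Proof.
move=> hb; apply: dim_ker_eq0 => v; have [U [V [P ->]]] := fieldsP v.
case/(rusanov_kernelP hb dx0 dy0) => -[[tU _] [tV _] [tP _]] _ _ _.
have z (X : 'M[C]_1) : jump 0 b (phase (kx * dx)) *m X = 0 -> X = 0.
  rewrite phase_pi // => /matrixP e; apply/matrixP => i j; rewrite !ord1 mxE.
  have := e 0 0; rewrite mxE big_ord1 jump_antiperiodic // mxE /= => /eqP.
  by rewrite mulf_eq0 pnatr_eq0 => /eqP.
by rewrite (z U) // (z V) // (z P) // fields0.
Qed.

Let o20 : 'I_2 := Ordinal (isT : 0 < 2)%N.
Let o21 : 'I_2 := Ordinal (isT : 1 < 2)%N.

Let sum2 (F : 'I_2 -> C) : \sum_i F i = F o20 + F o21.
Proof.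
by rewrite !big_ord_recl big_ord0 addr0; congr (F _ + F _); apply: val_inj.
Qed.

(** Antiperiodic continuity kills row 0 and column 0 of every field, leaving only the coefficient
    (1, 1); the pressure gradient and the divergence then kill that one. *)
Lemma rusanov_dim_ker1 : orthonormal_basis 1 b ->
  dim_ker (rusanov_evolution_matrix b dx dy 1 kx ky) = 0%N.
Proof.
move=> hb; apply: dim_ker_eq0 => v; have [U [V [P ->]]] := fieldsP v.
case/(rusanov_kernelP hb dx0 dy0); rewrite !phase_pi // trmxK => -[[tU Us] [tV Vs] [tP Ps]].
have jE a : jump 1 b (-1) 0 a = nth 0 [:: 2; 0; 2 * s5] a by exact: jump_antiperiodic.
have gE k a : stiffness 1 b k a = ((k : nat) == a.+1)%:R * nth 0 [:: 0; 2 * s3; 2 * s3 * s5] k.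
  by rewrite mxE (stiffC_legendre _ hb) ?leq_ord.
have row0 (X : 'M[C]_2) : jump 1 b (-1) *m X = 0 -> forall j, X o20 j = 0.
  move=> /matrixP e j; have := e 0 j; rewrite mxE sum2 !jE mxE /= mul0r addr0 => /eqP.
  by rewrite mulf_eq0 pnatr_eq0 => /eqP.
have col0 (X : 'M[C]_2) : X *m (jump 1 b (-1))^T = 0 -> forall j, X j o20 = 0.
  move=> e j; rewrite -[X]trmxK mxE; apply: row0.
  by apply: trmx_inj; rewrite trmx_mul trmxK e trmx0.
have all0 (X : 'M[C]_2) : jump 1 b (-1) *m X = 0 -> X *m (jump 1 b (-1))^T = 0 ->
    X o21 o21 = 0 -> X = 0.
  move=> /row0 r /col0 c d; apply/matrixP => i j; rewrite mxE.
  case: i => [[|[|//]] hi]; case: j => [[|[|//]] hj].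
  - by rewrite -[RHS](r o20); congr (X _ _); apply: val_inj.
  - by rewrite -[RHS](r o21); congr (X _ _); apply: val_inj.
  - by rewrite -[RHS](c o21); congr (X _ _); apply: val_inj.
  - by rewrite -[RHS]d; congr (X _ _); apply: val_inj.
have g0 : 2 * s3 != 0 by rewrite mulf_neq0 // pnatr_eq0.
move=> /matrixP /(_ o20 o21); rewrite mxE sum2 ![(stiffness _ _)^T _ _]mxE !gE mxE /=.
rewrite !(mul0r, mul1r, add0r) => /eqP; rewrite mulf_eq0 (negPf g0) => /eqP P11 _ /matrixP dv.
(* Entry (0, 1) of the divergence involves only U and entry (1, 0) only V, so no cancellation
   between the components is possible. *)
have := dv o20 o21; have := dv o21 o20.
rewrite !mxE !sum2 ![(stiffness _ _)^T _ _]mxE !gE /= !(row0 U, col0 V) //.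
rewrite !(mul0r, mulr0, mul1r, addr0, add0r) => /eqP.
rewrite !mulf_eq0 pnatr_eq0 (negPf s30) invr_eq0 (negPf dyn) !orbF /= => /eqP V11 /eqP.
rewrite !mulf_eq0 pnatr_eq0 (negPf s30) invr_eq0 (negPf dxn) /= => /eqP U11.
have U0 : U = 0 by exact: all0.
have V0 : V = 0 by exact: all0.
have P0 : P = 0 by exact: all0.
by rewrite U0 V0 P0 fields0.
Qed.

Let o30 : 'I_3 := Ordinal (isT : 0 < 3)%N.
Let o31 : 'I_3 := Ordinal (isT : 1 < 3)%N.
Let o32 : 'I_3 := Ordinal (isT : 2 < 3)%N.

Let sum3 (F : 'I_3 -> C) : \sum_i F i = F o30 + F o31 + F o32.
Proof.
rewrite !big_ord_recl big_ord0 addr0 addrA.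
by congr (F _ + F _ + F _); apply: val_inj.
Qed.

Let I3P (Q : 'I_3 -> Prop) : Q o30 -> Q o31 -> Q o32 -> forall i, Q i.
Proof.
move=> q0 q1 q2 [[|[|[|//]]] h]; [move: q0 | move: q1 | move: q2];
  by congr Q; apply: val_inj.
Qed.

Section Quadratic.
Hypothesis hb : orthonormal_basis 2 b.

Let stiffness_mul m (X : 'M[C]_(3, m)) i j : ((stiffness 2 b)^T *m X) i j =
  nth 0 [:: 2 * s3 * X o31 j; 2 * s3 * s5 * X o32 j; 0] i.
Proof.
have gE k a : stiffness 2 b k a = ((k : nat) == a.+1)%:R * nth 0 [:: 0; 2 * s3; 2 * s3 * s5] k.
  by rewrite mxE (stiffC_legendre _ hb) ?leq_ord.
rewrite mxE sum3 ![(stiffness _ _)^T _ _]mxE !gE /=.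
by move: i; apply: I3P => /=; ring.
Qed.

Let mul_stiffness (X : 'M[C]_3) i j : (X *m stiffness 2 b) i j =
  nth 0 [:: 2 * s3 * X i o31; 2 * s3 * s5 * X i o32; 0] j.
Proof.
by rewrite -[X in LHS]trmxK -[stiffness 2 b]trmxK -trmx_mul mxE stiffness_mul !mxE.
Qed.

Lemma rusanov_dim_ker2_le1 :
  (dim_ker (rusanov_evolution_matrix b dx dy 2 kx ky) <= 1)%N.
Proof.
(* The spanning velocity: the bubble [b 2 - s5 *: b 0], zero at both cell ends, in one direction
   times the antiperiodic [b 1] in the other. The factors dx and -dy make the divergence cancel. *)
pose U0 : 'M[C]_3 := \matrix_(i, j) (((j == o31)%:R * nth 0 [:: - s5; 0; 1] i) * dx%:C).
pose V0 : 'M[C]_3 := \matrix_(i, j) (((i == o31)%:R * nth 0 [:: s5; 0; - 1] j) * dy%:C).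
apply: (@dim_ker_le _ _ _ 1 (fields U0 V0 0)) => v; have [U [V [P ->]]] := fieldsP v.
case/(rusanov_kernelP hb dx0 dy0); rewrite !phase_pi // trmxK => -[[tU Us] [tV Vs] [tP Ps]].
have jE a : jump 2 b (-1) 0 a = nth 0 [:: 2; 0; 2 * s5] a by exact: jump_antiperiodic.
have row0 (X : 'M[C]_3) : jump 2 b (-1) *m X = 0 -> forall j, X o30 j = - s5 * X o32 j.
  move=> /matrixP e j; have := e 0 j; rewrite mxE sum3 !jE mxE /= mul0r addr0.
  rewrite -mulrA -mulrDr => /eqP; rewrite mulf_eq0 pnatr_eq0 addr_eq0 /= => /eqP ->.
  by rewrite mulNr.
have col0 (X : 'M[C]_3) : X *m (jump 2 b (-1))^T = 0 -> forall j, X j o30 = - s5 * X j o32.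
  move=> e j; have := row0 X^T _ j; rewrite !mxE; apply.
  by apply: trmx_inj; rewrite trmx_mul trmxK e trmx0.
have g1 (x : C) : 2 * s3 * x = 0 -> x = 0.
  by move=> /eqP; rewrite !mulf_eq0 pnatr_eq0 (negPf s30) => /eqP.
have g2 (x : C) : 2 * s3 * s5 * x = 0 -> x = 0.
  by move=> /eqP; rewrite !mulf_eq0 pnatr_eq0 (negPf s30) (negPf s50) => /eqP.
move=> /matrixP gx _ /matrixP dv.
have P0 : P = 0.
  have P1 j : P o31 j = 0 by have := gx o30 j; rewrite stiffness_mul mxE => /g1.
  have P2 j : P o32 j = 0 by have := gx o31 j; rewrite stiffness_mul mxE => /g2.
  apply/matrixP => i j; rewrite mxE; move: i; apply: I3P => //.
  by rewrite (row0 P) // P2 mulr0.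
have {}dv (i j : 'I_3) : nth 0 [:: 2 * s3 * U o31 j; 2 * s3 * s5 * U o32 j; 0] i / dx%:C +
    nth 0 [:: 2 * s3 * V i o31; 2 * s3 * s5 * V i o32; 0] j / dy%:C = 0.
  by have := dv i j; rewrite [LHS]mxE [X in X + _]mxE [X in _ + X]mxE [RHS]mxE stiffness_mul mul_stiffness ![_^-1 * _]mulrC.
have dvx (x : C) : x / dx%:C = 0 -> x = 0.
  by move=> /eqP; rewrite mulf_eq0 invr_eq0 (negPf dxn) orbF => /eqP.
have dvy (x : C) : x / dy%:C = 0 -> x = 0.
  by move=> /eqP; rewrite mulf_eq0 invr_eq0 (negPf dyn) orbF => /eqP.
(* Divergence entries with exactly one index 2 involve a single component, since no derivative has
   degree 2. Entries (0, 1) and (1, 0) then decouple by continuity, and entry (1, 1) is the one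
   relation left, tying V12 to U21. *)
have V21 : V o32 o31 = 0 by have := dv o32 o30; rewrite /= mul0r add0r => /dvy/g1.
have V22 : V o32 o32 = 0 by have := dv o32 o31; rewrite /= mul0r add0r => /dvy/g2.
have U12 : U o31 o32 = 0 by have := dv o30 o32; rewrite /= mul0r addr0 => /dvx/g1.
have U22 : U o32 o32 = 0 by have := dv o31 o32; rewrite /= mul0r addr0 => /dvx/g2.
have U11 : U o31 o31 = 0.
  have := dv o30 o31; rewrite /= (row0 V tV) V22 !mulr0 mul0r addr0.
  by move=> /dvx/g1.
have V11 : V o31 o31 = 0.
  have := dv o31 o30; rewrite /= (col0 U Us) U22 !mulr0 mul0r add0r.
  by move=> /dvy/g1.
have V12 : V o31 o32 = - (U o32 o31 / dx%:C * dy%:C).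
  have := dv o31 o31; rewrite /= -!mulrA -!mulrDr !mulrA => /g2 /eqP.
  rewrite addrC addr_eq0 => /eqP e.
  by rewrite -[LHS](divfK dyn) e mulNr.
(* The scalar is read off at entry (2, 1), where [U0] equals dx. *)
exists ((U o32 o31 / dx%:C)%:M); rewrite mul_mx_scalar -fieldsZ P0 scaler0.
have eU : U = (U o32 o31 / dx%:C) *: U0.
  apply/matrixP; do 2 apply: I3P; rewrite !mxE /= ?(row0 U tU) ?(col0 U Us) ?U11 ?U12 ?U22;
    by field.
have eV : V = (U o32 o31 / dx%:C) *: V0.
  apply/matrixP; do 2 apply: I3P; rewrite !mxE /= ?(row0 V tV) ?(col0 V Vs) ?V11 ?V12 ?V21 ?V22;
    by field.
by rewrite -eU -eV.
Qed.

(** * A stationary field of degree 2 for arbitrary phases *)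

Section Witness.
Variable r : C.

(* [ramp] spans the linear polynomials that are continuous across cell
   interfaces up to the phase [r]; [bump] is a continuous primitive of
   [(1 - r) *: ramp], scaled so as not to degenerate at [r = 1]. *)
Definition ramp : 'cV[C]_3 := \col_i nth 0 [:: s3 * (1 + r); r - 1; 0] i.

Definition bump : 'cV[C]_3 := \col_i nth 0
  [:: - (s3 * (1 + r) ^+ 2 / 2) + (1 - r) ^+ 2 / (2 * s3);
      (1 - r ^+ 2) / 2; - ((1 - r) ^+ 2 / (2 * s3 * s5))] i.

Let jumpE a : jump 2 b r 0 a = nth 0 [:: 1 - r; s3 * (1 + r); s5 * (1 - r)] a.
Proof.
rewrite mxE (bR_legendre _ hb) ?leq_ord // (bL_legendre _ hb) ?leq_ord // -/s3 -/s5.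
by move: a; apply: I3P => /=; ring.
Qed.

Lemma jump_ramp : jump 2 b r *m ramp = 0.
Proof. by apply/matrixP => i j; rewrite !ord1 mxE sum3 !jumpE !mxE /=; ring. Qed.

Lemma jump_bump : jump 2 b r *m bump = 0.
Proof.
apply/matrixP => i j; rewrite !ord1 mxE sum3 !jumpE !mxE /=; field.
by rewrite s30 s50.
Qed.

Lemma stiffness_bump : (stiffness 2 b)^T *m bump = (1 - r) *: ramp.
Proof.
apply/matrixP => i j; rewrite ord1 {j} stiffness_mul !mxE.
by move: i; apply: I3P => /=; field; rewrite ?s30 ?s50.
Qed.

Lemma ramp_neq0 : ramp != 0.
Proof.
apply/negP => /eqP/matrixP e; have := e o30 0; have := e o31 0.
rewrite !mxE /= => /eqP; rewrite subr_eq0 => /eqP -> /eqP.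
by rewrite mulf_eq0 (negPf s30) -[1 + 1]/(2 : C) pnatr_eq0.
Qed.

(** The top coefficient vanishes only at [r = 1], where [bump] is a nonzero constant. *)
Lemma bump_neq0 : bump != 0.
Proof.
apply/negP => /eqP/matrixP e; have := e o30 0; have := e o32 0.
rewrite !mxE /= => /eqP.
rewrite oppr_eq0 mulf_eq0 invr_eq0 !mulf_eq0 pnatr_eq0 (negPf s30) (negPf s50) !orbF.
rewrite orbb => /eqP d; rewrite d expr0n mul0r addr0.
have -> : 1 + r = 2 by rewrite -[r](subKr 1) d subr0.
move=> /eqP; rewrite oppr_eq0 !mulf_eq0 invr_eq0 (negPf s30).
by rewrite !pnatr_eq0.
Qed.

End Witness.

Lemma rusanov_dim_ker2_gt0 (lx ly : R) :
  (0 < dim_ker (rusanov_evolution_matrix b dx dy 2 lx ly))%N.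
Proof.
set t := phase (lx * dx); set s := phase (ly * dy).
have neq0 (x y : 'cV[C]_3) : x != 0 -> y != 0 -> x *m y^T != 0.
  move=> /eqP/matrixP x0 /eqP/matrixP y0; apply/negP => /eqP/matrixP e.
  apply: x0 => i j; rewrite ord1 [RHS]mxE; apply/eqP; apply/negPn/negP => xi.
  apply: y0 => k l; rewrite ord1 [RHS]mxE; apply/eqP.
  by have /eqP := e i k; rewrite mxE big_ord1 !mxE mulf_eq0 (negPf xi).
have modes (x y : 'cV[C]_3) : jump 2 b t *m x = 0 -> jump 2 b s *m y = 0 ->
    continuous_modes b t s (x *m y^T).
  move=> tx sy; split; first by rewrite mulmxA tx mul0mx.
  by rewrite -mulmxA -trmx_mul sy trmx0 mulmx0.
have modesZ c X : continuous_modes b t s X -> continuous_modes b t s (c *: X).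
  by case=> tX Xs; split; rewrite -?scalemxAl -?scalemxAr ?tX ?Xs scaler0.
have modes0 : continuous_modes b t s (0 : 'M[C]_3).
  by split; rewrite ?mulmx0 ?mul0mx.
(* At [t = 1] the factor [1 - t] of the general V vanishes; a shear flow, constant in x and directed
   along x, is divergence-free and replaces it. *)
have [t1|t1] := eqVneq t 1.
  pose e0 : 'cV[C]_3 := \col_i (i == o30)%:R.
  have e00 : e0 != 0.
    by apply/negP => /eqP/matrixP/(_ o30 0)/eqP; rewrite !mxE eqxx oner_eq0.
  have je0 : jump 2 b t *m e0 = 0.
    apply/matrixP => i j; rewrite !ord1 mxE sum3 !mxE /= !mulr0 !addr0 mulr1 t1.
    by rewrite (bR_legendre _ hb) // (bL_legendre _ hb) //= mul1r subrr.
  have De0 : (stiffness 2 b)^T *m e0 = 0.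
    apply/matrixP => i j; rewrite ord1 {j} stiffness_mul !mxE.
    by move: i; apply: I3P => /=; rewrite ?mulr0.
  apply: (@dim_ker_gt0 _ _ _ (fields (e0 *m (ramp s)^T) 0 0)).
    apply/negP => /eqP; rewrite -(fields0 _ 2) => /fields_inj [/eqP + _ _].
    by apply/negP/neq0 => //; exact: ramp_neq0.
  apply/(rusanov_kernelP hb dx0 dy0); rewrite trmxK mulmxA De0 !mul0mx mulmx0.
  split=> //; last by rewrite !scaler0 addr0.
  by split=> //; apply: modes => //; exact: jump_ramp.
(* The prefactors balance the derivatives: both divergence terms become [(1 - t) * (1 - s)] times
   the product of ramps, with opposite signs. As [t] differs from 1, V is nonzero. *)
pose U := (dx%:C * (1 - s)) *: (bump t *m (ramp s)^T).
pose V := (- dy%:C * (1 - t)) *: (ramp t *m (bump s)^T).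
apply: (@dim_ker_gt0 _ _ _ (fields U V 0)).
  apply/negP => /eqP; rewrite -(fields0 _ 2) => /fields_inj [_ /eqP + _].
  rewrite scaler_eq0 mulf_eq0 oppr_eq0 (negPf dyn) subr_eq0 eq_sym (negPf t1) /=.
  by apply/negP/neq0; [exact: ramp_neq0 | exact: bump_neq0].
apply/(rusanov_kernelP hb dx0 dy0); rewrite trmxK !mulmx0 !mul0mx.
split=> //.
  by split=> //; apply: modesZ; apply: modes; rewrite ?jump_ramp ?jump_bump.
rewrite /U /V -!scalemxAr -!scalemxAl mulmxA stiffness_bump -scalemxAl -mulmxA.
have -> : (bump s)^T *m stiffness 2 b = (1 - s) *: (ramp s)^T.
  by apply: trmx_inj; rewrite trmx_mul trmxK stiffness_bump linearZ /= trmxK.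
rewrite -scalemxAr !scalerA -scalerDl.
rewrite [X in X *: _](_ : _ = 0) ?scale0r //; field.
by rewrite dxn dyn.
Qed.

End Quadratic.
End LowDegree.

Theorem mainTheorem3 (R : realType) (dx dy : R) (hdx : 0 < dx) (hdy : 0 < dy)
    (K : nat) (b : nat -> {poly R}) (hb : orthonormal_basis K b) :
  let E := rusanov_evolution_matrix b dx dy K in
  [/\ (K = 0%N \/ K = 1%N -> is_min_dim_ker E 0),
      (K = 2%N -> is_min_dim_ker E 1),
      (K = 0%N \/ K = 1%N -> ~ stationarity_preserving E (K.+1 ^ 2)) &
      (K = 2%N -> stationarity_preserving E (K.+1 ^ 2))].
Proof.
move=> E.
have min0 : K = 0%N \/ K = 1%N -> is_min_dim_ker E 0.
  move=> K01; split=> //; exists (pi / dx), (pi / dy); rewrite /E.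
  case: K01 hb => -> hb'; [exact: rusanov_dim_ker0 | exact: rusanov_dim_ker1].
have min1 : K = 2%N -> is_min_dim_ker E 1.
  move=> K2; rewrite /E; move: hb; rewrite {}K2 => hb'.
  split; last exact: rusanov_dim_ker2_gt0.
  exists (pi / dx), (pi / dy); apply/eqP.
  by rewrite eqn_leq rusanov_dim_ker2_le1 ?rusanov_dim_ker2_gt0.
(* Any admissible minimum [m] is at most the kernel dimension 0 at this wave vector, contradicting
   [1 <= m]. *)
split=> // [/min0 [[kx [ky e]] _] [m [_ /(_ kx ky)]] | K2].
  by rewrite e leqn0 => /eqP ->.
by exists 1%N; [exact: min1 | rewrite K2].
Qed.
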